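(* Let $\pi\in S_N$ be a permutation such that $Y_\pi$ is toric and $L(\pi)$ is connected, and let $G^\pi$ be the associated connected bipartite graph with parts $U_1,U_2$. Then: (1) The one-sided first independent sets of $G^\pi$ are exactly the sets $U_i\setminus\{u_i\}$ for all $u_i\in U_i$ and $i=1,2$. (2) The two-sided first independent sets of $G^\pi$ are exactly the maximal two-sided independent sets of $G^\pi$.
   Context: Matrix Schubert varieties. Identify $\pi\in S_N$ with the $N\times N$ permutation matrix with entry $1$ at $(i,j)$ iff $\pi(j)=i$. Let $B_-$, $B_+$ be the groups of invertible lower, resp. upper, triangular $N\times N$ matrices; $\overline{X_\pi}=\overline{B_-\pi B_+}\subseteq\mathbb{C}^{N\times N}$ (Zariski closure). The Rothe diagram is $D(\pi)=\{(\pi(j),i): i<j,\ \pi(i)>\pi(j)\}$, whose elements are called boxes (row index, column index). $\operatorname{dom}(\pi)$ is the connected component of $D(\pi)$ containing $(1,1)$ (empty if $(1,1)\notin D(\pi)$), boxes being connected through common sides. $\operatorname{NW}(\pi)$ is the set of boxes $(a,b)$ for which there is $(c,d)\in D(\pi)$ with $a\le c$, $b\le d$. Put $L(\pi)=\operatorname{NW}(\pi)\setminus\operatorname{dom}(\pi)$. $Y_\pi$ is the projection of $\overline{X_\pi}$ to the coordinates indexed by $L(\pi)$. $(\mathbb{C}^* )^{2N}$ (pairs of invertible diagonal matrices) acts on $Y_\pi$ by $\mathcal{M}\mapsto D_1\mathcal{M}D_2^{-1}$; let $T$ be the quotient by the subgroup acting trivially. $Y_\pi$ is called toric if $\dim T=\dim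 Y_\pi$. Graph. $G^\pi$ is the bipartite graph with parts $U_1$ (the rows meeting $L(\pi)$) and $U_2$ (the columns meeting $L(\pi)$), with an edge joining $a\in U_1$ and $b\in U_2$ iff $(a,b)\in L(\pi)$. Independent sets of a connected bipartite graph $G$ with parts $U_1,U_2$. A nonempty set of vertices is independent if it contains no two adjacent vertices; an independent set $A\subsetneq V(G)$ is maximal if no other independent set contains it. An independent set is one-sided if it is contained in $U_1$ or in $U_2$; $A=A_1\sqcup A_2$ is two-sided if $\emptyset\ne A_1\subsetneq U_1$ and $\emptyset\ne A_2\subsetneq U_2$. $N(A)$ is the set of vertices adjacent to some vertex of $A$ and $G[A]$ is the induced subgraph. The associated bipartite subgraph $G\{A\}$ is the spanning subgraph of $G$ whose edges are those of $G[A\sqcup N(A)]\sqcup G[(U_i\setminus A)\sqcup(U_j\setminus N(A))]$ if $A\subseteq U_i$ is one-sided ($\{i,j\}=\{1,2\}$), and those of $G[A_1\sqcup N(A_1)]\sqcup G[A_2\sqcup N(A_2)]$ if $A=A_1\sqcup A_2$ is two-sided. The set $\mathcal{I}^{(1)}_G$ of first independent sets consists of those two-sided maximal independent sets and those one-sided independent sets of the form $U_i\setminus\{u\}$ (with $u \in U_i$) whose associated bipartite subgraph has exactly two connected components (isolated vertices count as components). *)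

(* Defs.v *)
From HB Require Import structures.
From mathcomp Require Import all_boot all_order all_fingroup all_algebra.
From mathcomp Require Import mpoly.
From mathcomp Require Import all_classical.
From mathcomp Require Import reals.
From mathcomp Require Import topology_structure subtype_topology.
From mathcomp Require Import quotient_topology.
From mathcomp Require Import complex.
From mathcomp Require Import ring.

Set Implicit Arguments.
Unset Strict Implicit.
Unset Printing Implicit Defensive.

Import GRing.Theory.
Local Open Scope ring_scope.

Section RotheDiagram.
Variables (N : nat) (pi : 'S_N).
Implicit Types (S : {set 'I_N * 'I_N}) (x y : 'I_N * 'I_N).

(* Boxes are pairs (row, column), numbered from 0: the usual corner box (1,1)
   is the one both of whose coordinates have value 0. *)
Definition rothe : {set 'I_N * 'I_N} :=
  [set x : 'I_N * 'I_N | [exists i : 'I_N, exists j : 'I_N,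
     [&& (i < j)%N, (pi j < pi i)%N & x == (pi j, i)]]].

Definition common_side x y : bool :=
  (x.1 == y.1) && ((x.2.+1 == y.2 :> nat) || (y.2.+1 == x.2 :> nat))
  || (x.2 == y.2) && ((x.1.+1 == y.1 :> nat) || (y.1.+1 == x.1 :> nat)).

Definition box_step S : rel ('I_N * 'I_N) :=
  [rel x y | [&& x \in S, y \in S & common_side x y]].

Definition boxes_connected S : Prop :=
  {in S &, forall x y, connect (box_step S) x y}.

Definition dom_region : {set 'I_N * 'I_N} :=
  [set x in rothe | [exists y in rothe,
     [&& y.1 == 0%N :> nat, y.2 == 0%N :> nat &
         connect (box_step rothe) y x]]].

Definition nw_region : {set 'I_N * 'I_N} :=
  [set x : 'I_N * 'I_N | [exists y in rothe, (x.1 <= y.1)%N && (x.2 <= y.2)%N]].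

Definition L_region : {set 'I_N * 'I_N} := nw_region :\: dom_region.

(* The vertices of the graph G^pi: row a is inl a, column b is inr b. *)
Definition Gpi_rows : {set 'I_N + 'I_N} := [set inl x.1 | x in L_region].
Definition Gpi_cols : {set 'I_N + 'I_N} := [set inr x.2 | x in L_region].

Definition Gpi_edge : rel ('I_N + 'I_N) := fun u v =>
  match u, v with
  | inl a, inr b | inr b, inl a => (a, b) \in L_region
  | _, _ => false
  end.

End RotheDiagram.

(* The bipartite graph with parts U1 and U2 and symmetric adjacency e; the
   elements of V outside U1 :|: U2 are not vertices. *)
Section IndependentSets.
Variables (V : finType) (U1 U2 : {set V}) (e : rel V).
Implicit Types A B : {set V}.

Definition vertices : {set V} := U1 :|: U2.

Definition independent A : bool :=
  [&& A != finset.set0, A \subset vertices &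
      [forall x in A, forall y in A, ~~ e x y]].

Definition maximal_independent A : bool :=
  [&& independent A, A \proper vertices &
      [forall B : {set V}, independent B && (A \subset B) ==> (B == A)]].

Definition one_sided A : bool :=
  independent A && ((A \subset U1) || (A \subset U2)).

Definition two_sided A : bool :=
  [&& independent A,
      A :&: U1 != finset.set0, A :&: U1 \proper U1,
      A :&: U2 != finset.set0 & A :&: U2 \proper U2].

Definition neighbours A : {set V} :=
  [set y in vertices | [exists x in A, e x y]].

Definition induced B : rel V := [rel x y | [&& x \in B, y \in B & e x y]].

(* The edges of the associated bipartite subgraph G{A}. *)
Definition assoc_edge A : rel V :=
  let two_pieces B C := [rel x y | induced B x y || induced C x y] in
  if A \subset U1 then
    two_pieces (A :|: neighbours A) ((U1 :\: A) :|: (U2 :\: neighbours A))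
  else if A \subset U2 then
    two_pieces (A :|: neighbours A) ((U2 :\: A) :|: (U1 :\: neighbours A))
  else
    two_pieces ((A :&: U1) :|: neighbours (A :&: U1))
               ((A :&: U2) :|: neighbours (A :&: U2)).

Definition first_independent A : bool :=
  ((two_sided A && maximal_independent A)
   || (one_sided A && ([exists u in U1, A == U1 :\ u]
                       || [exists u in U2, A == U2 :\ u])))
  && (n_comp (assoc_edge A) vertices == 2%N).

End IndependentSets.

Section Zariski.
Local Open Scope classical_set_scope.
Variables (K : fieldType) (I : finType).

(* The affine space K^I, with its Zariski topology. *)
Definition affine_space : Type := {ffun I -> K}.

Definition poly_eval (p : {mpoly K[#|I|]}) (x : affine_space) : K :=
  p.@[fun k => x (enum_val k)].

Definition zero_locus (S : set ({mpoly K[#|I|]})) : set affine_space :=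
  [set x | forall p, S p -> poly_eval p x = 0].

Definition zariski_open : set_system affine_space :=
  [set U | exists S, ~` U = zero_locus S].

Lemma zariski_openT : zariski_open setT.
Proof.
exists [set (1 : {mpoly K[#|I|]})]; apply/seteqP; split=> x; rewrite setCT // => /(_ 1 erefl).
by rewrite /poly_eval rmorph1 => /eqP; rewrite oner_eq0.
Qed.

Lemma zariski_openI : setI_closed zariski_open.
Proof.
move=> A B [S SA] [T TB].
exists [set p * q | p in S & q in T].
rewrite setCI SA TB; apply/seteqP; split=> [x SUTx _ [p Sp [q Tq <-]]|x STx].
  rewrite /poly_eval rmorphM; case: SUTx => [Sx|Tx].
    by rewrite [X in X * _](Sx p Sp) mul0r.
  by rewrite [X in _ * X](Tx q Tq) mulr0.
have [Sx|/existsNP[p /not_implyP[Sp px]]] := pselect (zero_locus S x).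
  by left.
right=> q Tq; have /STx/eqP : [set p * q | p in S & q in T] (p * q).
  by exists p => //; exists q.
by rewrite /poly_eval rmorphM mulf_eq0 => /orP[/eqP//|/eqP].
Qed.

Lemma zariski_open_bigcup (J : Type) (f : J -> set affine_space) :
  (forall j, zariski_open (f j)) -> zariski_open (\bigcup_j f j).
Proof.
move=> fopen; exists [set p | exists j, forall x, ~ f j x -> poly_eval p x = 0].
apply/seteqP; split=> [x fx p [j pj]|x Hx [j _ fjx]].
  by apply: pj => fjx; apply: fx; exists j.
have [S Sj] := fopen j.
have : zero_locus S x.
  move=> p Sp; apply: Hx; exists j => y fjy.
  have : zero_locus S y by rewrite -Sj.
  exact.
by rewrite -Sj.
Qed.

HB.instance Definition _ := Choice.copy affine_space {ffun I -> K}.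
HB.instance Definition _ := isOpenTopological.Build affine_space
  zariski_openT zariski_openI zariski_open_bigcup.

End Zariski.

(* Dimension of a topological space: the supremum of the lengths n of the
   chains Z_0 < Z_1 < ... < Z_n of irreducible closed subsets. *)
Section KrullDimension.
Local Open Scope classical_set_scope.
Variable T : topologicalType.

Definition irreducible_closed (Z : set T) : Prop :=
  [/\ closed Z, Z !=set0 &
      forall A B : set T, closed A -> closed B -> Z `<=` A `|` B ->
        Z `<=` A \/ Z `<=` B].

Definition irreducible_chain (n : nat) : Prop :=
  exists Z : nat -> set T,
    (forall i, (i <= n)%N -> irreducible_closed (Z i)) /\
    (forall i, (i < n)%N -> Z i `<` Z i.+1).

Definition has_dim (d : nat) : Prop :=
  irreducible_chain d /\ (forall n, irreducible_chain n -> (n <= d)%N).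

End KrullDimension.

Section MatrixSchubert.
Local Open Scope classical_set_scope.
Variables (K : fieldType) (N : nat) (pi : 'S_N).

(* Not perm_mx pi, which is the transpose. *)
Definition permutation_matrix : 'M[K]_N := \matrix_(i, j) (pi j == i)%:R.

Definition matrix_point (M : 'M[K]_N) : affine_space K ('I_N * 'I_N)%type :=
  [ffun x => M x.1 x.2].

Definition schubert_cell : set 'M[K]_N :=
  [set M | exists b c : 'M[K]_N,
     [/\ b \in unitmx /\ is_trig_mx b,
         c \in unitmx /\ is_trig_mx c^T &
         M = b *m permutation_matrix *m c]].

Definition matrix_schubert : set (affine_space K ('I_N * 'I_N)%type) :=
  closure (matrix_point @` schubert_cell).

Definition L_box : finType := {x : 'I_N * 'I_N | x \in L_region pi}.

Definition L_projection (M : affine_space K ('I_N * 'I_N)%type) :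
  affine_space K L_box := [ffun x => M (val x)].

Definition Y_pi : set (affine_space K L_box) := L_projection @` matrix_schubert.

(* A pair (D1, D2) of diagonal matrices is a point t of K^(N + N), with
   D1 = diag(t (inl _)) and D2 = diag(t (inr _)). *)
Definition torus : set (affine_space K ('I_N + 'I_N)%type) :=
  [set t | forall i, t i != 0].

(* The entries of D1 M D2^-1 at the boxes of L(pi). *)
Definition torus_act (t : affine_space K ('I_N + 'I_N)%type)
    (y : affine_space K L_box) : affine_space K L_box :=
  [ffun x => t (inl (val x).1) * y x * (t (inr (val x).2))^-1].

Definition acts_trivially (t : affine_space K ('I_N + 'I_N)%type) : Prop :=
  forall y, Y_pi y -> torus_act t y = y.

Definition torus_div (s t : affine_space K ('I_N + 'I_N)%type) :
  affine_space K ('I_N + 'I_N)%type := [ffun i => s i / t i].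

(* s and t lie in the same coset of the subgroup acting trivially. *)
Definition same_coset : rel (set_type torus) := fun s t =>
  `[< acts_trivially (torus_div (set_val s) (set_val t)) >].

Lemma torus_neq0 (t : set_type torus) i : set_val t i != 0.
Proof. by case: t => t tT; rewrite set_valE; exact: (set_mem tT). Qed.

Lemma same_cosetP (s t : set_type torus) :
  reflect (forall y, Y_pi y ->
             torus_act (set_val s) y = torus_act (set_val t) y)
          (same_coset s t).
Proof.
have key (y : affine_space K L_box) x :
    (torus_act (torus_div (set_val s) (set_val t)) y x == y x) =
    (torus_act (set_val s) y x == torus_act (set_val t) y x).
  rewrite !ffunE; set s1 := set_val s _; set t1 := set_val t _.
  set s2 := set_val s (inr _); set t2 := set_val t (inr _).
  have [s10 t10] : s1 != 0 /\ t1 != 0 by split; exact: torus_neq0.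
  have [s20 t20] : s2 != 0 /\ t2 != 0 by split; exact: torus_neq0.
  rewrite invf_div.
  apply/eqP/eqP => [{2}<-|st]; first by field; rewrite ?s10 ?t10 ?s20 ?t20.
  have -> : s1 / t1 * y x * (t2 / s2) = s1 * y x / s2 * (t2 / t1).
    by field; rewrite ?s10 ?t10 ?s20 ?t20.
  by rewrite st; field; rewrite ?s10 ?t10 ?s20 ?t20.
rewrite /same_coset; apply: (iffP (asboolP _)) => H y Yy; apply/ffunP => x; apply/eqP.
  by rewrite -key H.
by rewrite key H.
Qed.

Lemma same_coset_refl : reflexive same_coset.
Proof. by move=> t; apply/same_cosetP. Qed.

Lemma same_coset_sym : ssrbool.symmetric same_coset.
Proof.
by move=> s t; apply/same_cosetP/same_cosetP => H y Yy; rewrite H.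
Qed.

Lemma same_coset_trans : transitive same_coset.
Proof.
move=> t s u /same_cosetP st /same_cosetP tu; apply/same_cosetP => y Yy.
by rewrite st ?tu.
Qed.

Canonical same_coset_equiv := EquivRel same_coset
  same_coset_refl same_coset_sym same_coset_trans.

(* The underlying space of a quotient of algebraic groups carries the quotient
   of the Zariski topology. *)
Definition quotient_torus : topologicalType :=
  quotient_topology {eq_quot same_coset_equiv}%qT.

Definition toric : Prop :=
  exists2 d : nat, has_dim quotient_torus d & has_dim (set_type Y_pi) d.

End MatrixSchubert.

(* Main.v *)
Require Import Defs.
From mathcomp Require Import all_boot all_order all_fingroup all_algebra.
From mathcomp Require Import mpoly.
From mathcomp Require Import all_classical.
From mathcomp Require Import topology_structure initial_topology subtype_topology.
From mathcomp Require Import quotient_topology.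
From mathcomp Require Import ring.
From mathcomp Require Import reals complex generic_quotient.

(* Fix a point y0 of Y whose coordinates are all nonzero.  The orbit map
   T -> Y, t |-> t y0, is a homeomorphism onto its image, because the ratios of
   the coordinates of t are regular functions of t y0 when L is connected.  So
   the closures of the images of a longest chain in T form a chain in Y, and if
   the orbit were not dense, the irreducible space Y would extend it: being
   toric forces the orbit of y0 to be dense.  Then the binomials that vanish on
   the orbit vanish on Y.  For a box (c, d) of the Rothe diagram with two
   dots (pi k, k) to its north-west, one such 2 x 2 binomial fails on Y.  Hence
   every box of L has exactly one dot weakly north-west of it, and since L is
   connected it is the same dot (pi k, k) for all boxes.  Then row pi k is
   adjacent in the graph to all columns and column k to all rows; these two
   hubs make each of the two pieces of G{A} connected. *)

Set Implicit Arguments.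
Unset Strict Implicit.
Unset Printing Implicit Defensive.

Import GRing.Theory Num.Theory.

(** * Counting components of a graph made of two disjoint pieces *)

Section TwoPieces.
Variables (V : finType) (e : rel V).
Hypothesis e_sym : forall x y, e x y = e y x.
Implicit Types B C : {set V}.

Lemma induced_sub B x y : induced e B x y -> x \in B /\ y \in B.
Proof. by case/and3P. Qed.

(** Vertices on the opposite side are reached from the hub in one edge, those on the hub's own side
    in two, through some [w] that stays inside the piece. *)
Lemma hub_connect B h u :
  h \in B -> u \in B -> [\/ u = h, e h u | exists w, [/\ w \in B, e h w & e w u]] ->
  connect (induced e B) h u.
Proof.
move=> hB uB [->|hu|[w [wB hw wu]]]; first exact: connect0.
  by apply: connect1; rewrite /induced /= hB uB.
by apply: (connect_trans (y := w)); apply: connect1; rewrite /induced /= ?hB ?uB wB.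
Qed.

(** Since the pieces are disjoint, no edge of the joint relation leaves either one. So each piece is
    exactly one connectivity class, and the count of roots splits as 1 + 1. *)
Lemma two_pieces_n_comp B C x y :
  [disjoint B & C] -> x \in B -> y \in C ->
  {in B, forall u, connect (induced e B) x u} ->
  {in C, forall u, connect (induced e C) y u} ->
  n_comp [rel u v | induced e B u v || induced e C u v] (B :|: C) = 2%N.
Proof.
set r := [rel u v | _ ] => dBC xB yC xconn yconn.
have ind_sym D u v : induced e D u v = induced e D v u.
  by rewrite /induced /= e_sym; case: (u \in D); case: (v \in D).
have r_sym : connect_sym r.
  by apply: sym_connect_sym => u v; rewrite /r /= ind_sym (ind_sym C).
have r_in D z : (D = B \/ D = C) -> z \in D ->
    {in D, forall u, connect (induced e D) z u} -> connect r z =i D.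
  move=> DBC zD zconn u; apply/idP/idP => [|uD].
    have Dcl : fingraph.closed r (mem D).
      move=> v w /orP[] /induced_sub[vE wE].
        case: DBC => ->; first by rewrite vE wE.
        by rewrite (disjointFr dBC vE) (disjointFr dBC wE).
      case: DBC => ->; last by rewrite vE wE.
      by rewrite (disjointFl dBC vE) (disjointFl dBC wE).
    by move=> /(closed_connect Dcl) <-.
  have /connect_sub := zconn _ uD; apply=> v w vw; apply: connect1.
  by rewrite /r /=; case: DBC vw => -> ->; rewrite ?orbT.
rewrite /n_comp_mem.
have -> : #|predI (roots r) (mem (B :|: C))| = (n_comp r B + n_comp r C)%N.
  rewrite /n_comp_mem -(cardID (mem B)); congr (_ + _)%N; apply: eq_card => v;
    rewrite !inE; case: (boolP (v \in B)) => vB; rewrite ?andbT ?andbF //=.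
  by rewrite (disjointFr dBC vB) andbF.
rewrite -(eq_n_comp_r (r_in B x (or_introl erefl) xB xconn)).
rewrite -(eq_n_comp_r (r_in C y (or_intror erefl) yC yconn)).
by rewrite !n_comp_connect.
Qed.

End TwoPieces.

(** * Independent sets in a bipartite graph with a hub in each part *)

Section Hubs.
Variables (V : finType) (e : rel V).
Hypothesis e_sym : forall x y, e x y = e y x.
Implicit Types U A : {set V}.

Definition hub_for (U : {set V}) (h : V) := {in U, forall v, e h v}.

Definition bipartite (U1 U2 : {set V}) :=
  [disjoint U1 & U2] /\
  forall x y, e x y -> (x \in U1) && (y \in U2) || (x \in U2) && (y \in U1).

Lemma bipartiteC U1 U2 : bipartite U1 U2 -> bipartite U2 U1.
Proof.
move=> [dU eU]; split=> [|x y /eU]; first by rewrite disjoint_sym.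
by rewrite orbC.
Qed.

Lemma bipartite_indep U1 U2 : bipartite U1 U2 -> {in U1 &, forall x y, ~~ e x y}.
Proof.
move=> [dU eU] x y xU yU; apply/negP=> /eU.
by rewrite (disjointFr dU xU) (disjointFr dU yU) andbF.
Qed.

Lemma neighboursC U1 U2 (A : {set V}) : neighbours U1 U2 e A = neighbours U2 U1 e A.
Proof. by rewrite /neighbours /vertices finset.setUC. Qed.

Lemma neighboursP U1 U2 (A : {set V}) y :
  reflect (y \in U1 :|: U2 /\ exists2 x, x \in A & e x y) (y \in neighbours U1 U2 e A).
Proof.
rewrite [y \in neighbours _ _ _ _]inE; apply: (iffP andP) => -[yV].
  by move=> /existsP[x /andP[xA xy]]; split=> //; exists x.
by move=> [x xA xy]; split=> //; apply/existsP; exists x; rewrite xA.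
Qed.

Lemma neighbours_sub U1 U2 (A : {set V}) : bipartite U1 U2 -> A \subset U1 ->
  neighbours U1 U2 e A \subset U2.
Proof.
move=> [dU eU] AU; apply/fintype.subsetP => y /neighboursP[_ [x /(fintype.subsetP AU) xU]].
by move=> /eU; rewrite xU (disjointFr dU xU) orbF.
Qed.

(** As [U1] has a second vertex, [U1 :\ u] is nonempty and has [b] as a neighbour; [b] then holds
    the first piece together. The second piece consists of [u] and the vertices of [U2] adjacent to
    nothing in [U1 :\ u]. *)
Lemma one_sided_n_comp U1 U2 a b u :
  bipartite U1 U2 -> a \in U1 -> b \in U2 -> hub_for U2 a -> hub_for U1 b ->
  1 < #|U1| -> u \in U1 ->
  n_comp (assoc_edge U1 U2 e (U1 :\ u)) (vertices U1 U2) = 2%N.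
Proof.
move=> bU aU bU2 ha hb U1gt uU; have [dU eU] := bU.
set A := U1 :\ u; rewrite /assoc_edge subD1set /vertices.
move NAE: (neighbours U1 U2 e A) => NA.
have NAU : NA \subset U2 by rewrite -NAE; apply: neighbours_sub => //; exact: subD1set.
have U1A : U1 :\: A = [set u].
  by apply/setP=> v; rewrite !inE negb_and negbK; case: eqP => [->|] //=; rewrite andNb.
have AUU : A :|: [set u] = U1 by rewrite finset.setUC finset.setD1K.
have NAUU : NA :|: (U2 :\: NA) = U2.
  by apply/setP=> v; rewrite !inE; case: (boolP (v \in NA)) => //= /(fintype.subsetP NAU) ->.
have -> : U1 :|: U2 = (A :|: NA) :|: ((U1 :\: A) :|: (U2 :\: NA)).
  by rewrite finset.setUACA U1A AUU NAUU.
have U1U2 v : v \in U1 -> (v \in U2) = false by exact: disjointFr.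
have [w wA] : exists w, w \in A.
  by apply/set0Pn; rewrite -card_gt0 (cardsD1 u U1) uU in U1gt *.
have NAbP : b \in NA.
  rewrite -NAE; apply/neighboursP; rewrite inE bU2 orbT; split=> //; exists w => //.
  by rewrite e_sym hb //; move: wA; rewrite inE => /andP[].
apply: (@two_pieces_n_comp _ _ e_sym _ _ b u).
- rewrite -finset.setI_eq0; apply/eqP/setP=> v; rewrite U1A !inE.
  case: (boolP (v \in NA)) => vN /=; last first.
    by case: eqP => //= _; rewrite orbF; case: (boolP (v \in U1)) => [/U1U2|].
  rewrite orbT /= orbF; apply/eqP=> vu; move: (fintype.subsetP NAU _ vN).
  by rewrite vu U1U2.
- by rewrite inE NAbP orbT.
- by rewrite U1A !inE eqxx.
- move=> v vB; apply: hub_connect => //; first by rewrite inE NAbP orbT.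
  move: vB; rewrite inE => /orP[]; first by rewrite inE => /andP[_ vU]; apply: Or32; exact: hb.
  rewrite -NAE => /neighboursP[_ [x xA xv]]; apply: Or33; exists x; split=> //.
    by rewrite inE xA.
  by apply: hb; move: xA; rewrite inE => /andP[].
- move=> v vC; apply: hub_connect => //; first by rewrite U1A !inE eqxx.
  move: vC; rewrite U1A !inE => /orP[/eqP|/andP[vN vU]]; first exact: Or31.
  (* If [u] is the hub [a], it is adjacent to all of [U2]. Otherwise [a] lies in [A], every vertex
     of [U2] is a neighbour of [A], and no such [v] is left. *)
  apply: Or32; have [<-|/eqP au] := eqVneq a u; first exact: ha.
  case/negP: vN; rewrite -NAE; apply/neighboursP; split; first by rewrite inE vU orbT.
  by exists a; [rewrite !inE aU andbT; exact/eqP | exact: ha].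
Qed.

(** [assoc_edge] tests containment in its first part first. A nonempty [A] in [U2] fails this test
    for [U1] by disjointness, so both orders of the parts yield the same pieces. *)
Lemma assoc_edgeC U1 U2 (A : {set V}) : [disjoint U1 & U2] ->
  A != finset.set0 -> A \subset U2 -> assoc_edge U1 U2 e A = assoc_edge U2 U1 e A.
Proof.
move=> dU /set0Pn[x xA] AU; rewrite /assoc_edge AU neighboursC.
case: ifP => // /fintype.subsetP/(_ _ xA) xU1.
by move: (fintype.subsetP AU _ xA); rewrite (disjointFr dU xU1).
Qed.

Lemma setD1_one_sided U1 U2 u :
  bipartite U1 U2 -> u \in U1 -> 1 < #|U1| -> one_sided U1 U2 e (U1 :\ u).
Proof.
move=> bU uU U1gt; rewrite /one_sided subD1set andbT /independent; apply/and3P; split.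
- by rewrite -card_gt0 (cardsD1 u U1) uU in U1gt *.
- by apply: fintype.subset_trans (subD1set _ _) _; exact: finset.subsetUl.
- apply/'forall_implyP => x; rewrite inE => /andP[_ xU].
  apply/'forall_implyP => y; rewrite inE => /andP[_ yU].
  exact: bipartite_indep bU _ _ xU yU.
Qed.

Lemma one_sidedC U1 U2 A : one_sided U1 U2 e A = one_sided U2 U1 e A.
Proof.
by rewrite /one_sided /independent /vertices finset.setUC; congr (_ && _); rewrite orbC.
Qed.

Lemma one_sidedN_two_sided U1 U2 A :
  bipartite U1 U2 -> one_sided U1 U2 e A -> two_sided U1 U2 e A = false.
Proof.
move=> [dU _] /andP[_ /orP[] AU]; apply/negP => /and5P[_ n1 _ n2 _].
  case/set0Pn: n2 => x; rewrite inE => /andP[/(fintype.subsetP AU) xU1].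
  by rewrite (disjointFr dU xU1).
case/set0Pn: n1 => x; rewrite inE => /andP[/(fintype.subsetP AU) xU1].
by rewrite (disjointFl dU xU1).
Qed.

(** Maximality gives each vertex outside [A] a neighbour in [A], so [A1] has neighbourhood
    [U2 :\: A] and [A2] has [U1 :\: A]. The hubs lie outside [A], because each is adjacent to some
    element of [A]; hence [b] is the centre of the piece of [A1] and [a] that of [A2]. *)
Lemma two_sided_n_comp U1 U2 a b A :
  bipartite U1 U2 -> a \in U1 -> b \in U2 -> hub_for U2 a -> hub_for U1 b ->
  two_sided U1 U2 e A -> maximal_independent U1 U2 e A ->
  n_comp (assoc_edge U1 U2 e A) (vertices U1 U2) = 2%N.
Proof.
move=> bU aU bU2 ha hb tsA maxA; have [dU eU] := bU; have bUC := bipartiteC bU.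
have [/and3P[A0 AV /'forall_implyP indA] n1 _ n2 _] := and5P tsA.
have {}indA x y : x \in A -> y \in A -> ~~ e x y.
  by move=> /indA/'forall_implyP; exact.
have [/set0Pn[x1 x1A] /set0Pn[x2 x2A]] := (n1, n2).
have [x1A' x1U] : x1 \in A /\ x1 \in U1 by move: x1A; rewrite inE => /andP.
have [x2A' x2U] : x2 \in A /\ x2 \in U2 by move: x2A; rewrite inE => /andP.
have U1U2 v : v \in U1 -> (v \in U2) = false by exact: disjointFr.
have nA1 : (A \subset U1) = false.
  by apply/negP=> /fintype.subsetP/(_ _ x2A') /U1U2; rewrite x2U.
have nA2 : (A \subset U2) = false.
  by apply/negP=> /fintype.subsetP/(_ _ x1A'); rewrite U1U2.
rewrite /assoc_edge nA1 nA2; set A1 := A :&: U1; set A2 := A :&: U2.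
(* Otherwise [v |: A] would be a larger independent set. *)
have max v : v \in U1 :|: U2 -> v \notin A -> exists2 w, w \in A & e w v.
  move=> vV vA; have [_ _ /forallP/(_ (v |: A))] := and3P maxA.
  rewrite finset.subsetUr andbT => /implyP H; apply/exists_inP/contraT.
  rewrite negb_exists_in => /forall_inP vN.
  suff /H/eqP/setP/(_ v) : independent U1 U2 e (v |: A) by rewrite !inE eqxx (negbTE vA).
  apply/and3P; split; first by apply/set0Pn; exists v; rewrite !inE eqxx.
    by rewrite finset.subUset finset.sub1set vV.
  have vv : ~~ e v v by apply/negP=> /eU/orP[] /andP[vU]; rewrite ?U1U2 // => /U1U2; rewrite vU.
  apply/'forall_implyP => x; rewrite 2!inE => xvA; apply/'forall_implyP => y; rewrite 2!inE => yvA.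
  case/orP: xvA => [/eqP->|xA]; case/orP: yvA => [/eqP->|yA] //.
  - by rewrite e_sym vN.
  - exact: vN.
  - exact: indA.
set N1 := neighbours U1 U2 e A1; set N2 := neighbours U1 U2 e A2.
have N1E v : (v \in N1) = (v \in U2) && (v \notin A).
  apply/neighboursP/andP => [[_ [x]]|[vU vA]].
    rewrite inE => /andP[xA xU] xv; split; last first.
      by apply/negP=> /(indA _ _ xA); rewrite xv.
    by case/orP: (eU _ _ xv) => /andP[] //; rewrite U1U2.
  have vV : v \in U1 :|: U2 by rewrite inE vU orbT.
  split=> //; have [w wA wv] := max _ vV vA; exists w => //; rewrite inE wA /=.
  by case/orP: (eU _ _ wv) => /andP[] // _ /U1U2; rewrite vU.
have N2E v : (v \in N2) = (v \in U1) && (v \notin A).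
  apply/neighboursP/andP => [[_ [x]]|[vU vA]].
    rewrite inE => /andP[xA xU] xv; split; last first.
      by apply/negP=> /(indA _ _ xA); rewrite xv.
    by case/orP: (eU _ _ xv) => /andP[] // /U1U2; rewrite xU.
  have vV : v \in U1 :|: U2 by rewrite inE vU.
  split=> //; have [w wA wv] := max _ vV vA; exists w => //; rewrite inE wA /=.
  by case/orP: (eU _ _ wv) => /andP[] // _; rewrite U1U2.
have -> : vertices U1 U2 = (A1 :|: N1) :|: (A2 :|: N2).
  apply/setP=> v; rewrite /vertices !finset.in_setU N1E N2E !finset.in_setI.
  by case: (v \in A); case: (v \in U1); case: (v \in U2).
have bN : b \in N1 by rewrite N1E bU2; apply/negP=> /(indA _ _ x1A'); rewrite e_sym hb.
have aN : a \in N2 by rewrite N2E aU; apply/negP=> /indA/(_ x2A'); rewrite ha.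
apply: (@two_pieces_n_comp _ _ e_sym _ _ b a).
- rewrite -finset.setI_eq0; apply/eqP/setP=> v.
  rewrite finset.in_setI !finset.in_setU N1E N2E !finset.in_setI finset.in_set0.
  case: (boolP (v \in U1)) => [/U1U2 ->|]; by case: (v \in A); rewrite /= ?andbF.
- by rewrite inE bN orbT.
- by rewrite inE aN orbT.
- move=> v vB; apply: hub_connect => //; first by rewrite inE bN orbT.
  move: vB; rewrite inE => /orP[]; first by rewrite inE => /andP[_ vU]; apply: Or32; exact: hb.
  move=> /neighboursP[_ [x xA xv]]; apply: Or33; exists x; split=> //.
    by rewrite inE xA.
  by apply: hb; move: xA; rewrite inE => /andP[].
- move=> v vB; apply: hub_connect => //; first by rewrite inE aN orbT.
  move: vB; rewrite inE => /orP[]; first by rewrite inE => /andP[_ vU]; apply: Or32; exact: ha.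
  move=> /neighboursP[_ [x xA xv]]; apply: Or33; exists x; split=> //.
    by rewrite inE xA.
  by apply: ha; move: xA; rewrite inE => /andP[].
Qed.

(** No set is both one-sided and two-sided, so each claim meets only one clause of
    [first_independent]; the component count is then automatic by the two lemmas on [n_comp]. *)
Lemma hubs_first_independent U1 U2 a b :
  bipartite U1 U2 -> a \in U1 -> b \in U2 -> hub_for U2 a -> hub_for U1 b ->
  1 < #|U1| -> 1 < #|U2| ->
  (forall A : {set V},
     first_independent U1 U2 e A && one_sided U1 U2 e A <->
     (exists2 u, u \in U1 & A = U1 :\ u) \/ (exists2 u, u \in U2 & A = U2 :\ u))
  /\
  (forall A : {set V},
     first_independent U1 U2 e A && two_sided U1 U2 e A <->
     two_sided U1 U2 e A && maximal_independent U1 U2 e A).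
Proof.
move=> bU aU bU2 ha hb U1gt U2gt; have bUC := bipartiteC bU; split=> A.
  split=> [/andP[/andP[]]|].
    move=> + _ osA; rewrite (one_sidedN_two_sided bU osA) /= osA /=.
    move=> /orP[] /existsP[u /andP[uU /eqP->]]; [left|right]; by exists u.
  case=> -[u uU ->].
    have os : one_sided U1 U2 e (U1 :\ u) by exact: setD1_one_sided.
    rewrite /first_independent os andbT (one_sided_n_comp bU aU bU2) // eqxx andbT.
    by apply/orP; right; apply/orP; left; apply/existsP; exists u; rewrite uU eqxx.
  have os : one_sided U1 U2 e (U2 :\ u) by rewrite one_sidedC; exact: setD1_one_sided.
  rewrite /first_independent os andbT assoc_edgeC ?subD1set //; last 2 first.
    by case: bU.
    by case/andP: os => /and3P[].
  rewrite /vertices finset.setUC (one_sided_n_comp bUC bU2 aU) // eqxx andbT.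
  by apply/orP; right; apply/orP; right; apply/existsP; exists u; rewrite uU eqxx.
split=> [/andP[/andP[+ _] tsA]|/andP[tsA mA]].
  rewrite tsA /= => /orP[//|/andP[/(one_sidedN_two_sided bU)]].
  by rewrite tsA.
by rewrite /first_independent tsA mA (two_sided_n_comp bU aU bU2).
Qed.

End Hubs.

Local Open Scope ring_scope.

(** * Irreducible chains under continuous maps *)

Section Dimension.
Local Open Scope classical_set_scope.

(** A cover of the closure by two closed sets pulls back along [f] to such a cover of [Z]. *)
Lemma irreducible_closure_image (X Y : topologicalType) (f : X -> Y) (Z : set X) :
  continuous f -> irreducible_closed Z -> irreducible_closed (closure (f @` Z)).
Proof.
move=> f_cont [Zcl [z Zz] Zirr]; split; first exact: closed_closure.
  by exists (f z); apply: subset_closure; exists z.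
move=> A B Acl Bcl ZAB.
have cl (C : set Y) : closed C -> closed (f @^-1` C) by move=> Ccl; exact: preimage_closed.
have sub (C : set Y) : closed C -> Z `<=` f @^-1` C -> closure (f @` Z) `<=` C.
  move=> /closure_id Ccl ZC; rewrite Ccl; apply: closureS => _ [x Zx <-].
  exact: ZC.
have [|ZA|ZB] := Zirr _ _ (cl _ Acl) (cl _ Bcl).
- by move=> x Zx; apply: ZAB; apply: subset_closure; exists x.
- by left; exact: sub.
- by right; exact: sub.
Qed.

(* If the image were not dense, the closures of the images of a chain of
   maximal length could be extended by the whole space. *)
Lemma dense_range_of_dim (X Y : topologicalType) (f : X -> Y) (d : nat) :
  continuous f ->
  (forall Z, closed Z -> f @^-1` closure (f @` Z) `<=` Z) ->
  irreducible_closed [set: Y] -> has_dim X d -> has_dim Y d ->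
  closure (range f) = [set: Y].
Proof.
move=> f_cont f_emb Yirr [[Z [Zirr Zlt]] _] [_ Ymax]; apply: contrapT => not_dense.
suff /Ymax : irreducible_chain Y d.+1 by rewrite ltnn.
exists (fun i => if (i <= d)%N then closure (f @` Z i) else setT); split=> i.
  by case: ifP => [id _|//]; apply: irreducible_closure_image => //; exact: Zirr.
rewrite ltnS => id; rewrite id; case: ltnP => [lt_id|_].
  have [sub nsub] := Zlt _ lt_id; split; first by apply: closureS; exact: image_subset.
  (* Inclusions stay strict because [f_emb] recovers the closed set [Z i] from the closure of its
     image. *)
  move=> sub'; apply: nsub => z Zz; have [Zcl _ _] := Zirr _ id.
  by apply: f_emb => //; apply: sub'; apply: subset_closure; exists z.
split=> // sub; apply: not_dense; apply/seteqP; split=> // y yT.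
by apply: closureS (sub _ yT); exact: image_subset.
Qed.

End Dimension.

(** * Polynomial evaluation and regular functions *)

Section PolyEval.
Variables (K : fieldType) (I : finType) (x : affine_space K I).
Implicit Types p q : {mpoly K[#|I|]}.

Lemma poly_evalC c : poly_eval c%:MP x = c.
Proof. exact: mevalC. Qed.

Lemma poly_eval1 : poly_eval 1 x = 1.
Proof. exact: meval1. Qed.

Lemma poly_evalX k : poly_eval 'X_k x = x (enum_val k).
Proof. exact: mevalXU. Qed.

Lemma poly_evalD p q : poly_eval (p + q) x = poly_eval p x + poly_eval q x.
Proof. exact: mevalD. Qed.

Lemma poly_evalB p q : poly_eval (p - q) x = poly_eval p x - poly_eval q x.
Proof. exact: mevalB. Qed.

Lemma poly_evalM p q : poly_eval (p * q) x = poly_eval p x * poly_eval q x.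
Proof. exact: mevalM. Qed.

End PolyEval.

Section RegularFunctions.
Local Open Scope classical_set_scope.
Variables (K : fieldType).

(** Expanding [p] into monomials leaves only sums, products and powers. It serves both for regular
    functions and for polynomial functions of a line parameter. *)
Lemma poly_eval_ind (T : Type) (J : finType) (psi : T -> affine_space K J)
    (C : (T -> K) -> Prop) (p : {mpoly K[#|J|]}) :
  (forall c, C (fun=> c)) ->
  (forall F G, C F -> C G -> C (fun t => F t + G t)) ->
  (forall F G, C F -> C G -> C (fun t => F t * G t)) ->
  (forall j, C (fun t => psi t j)) -> C (fun t => poly_eval p (psi t)).
Proof.
move=> Ccst CD CM Cpsi.
have -> : (fun t => poly_eval p (psi t)) = (fun t => \sum_(m <- msupp p)
    p@_m * \prod_(k < #|J|) psi t (enum_val k) ^+ m k).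
  by apply/funext => t; rewrite /poly_eval mevalE.
elim: (msupp p) => [|m s IHs].
  by under [X in C X]funext do rewrite big_nil; exact: Ccst.
under [X in C X]funext do rewrite big_cons.
apply: (CD _ _ _ IHs); apply: (CM _ _ (Ccst _)).
elim: (index_enum _) => [|k r IHr].
  by under [X in C X]funext do rewrite big_nil; exact: Ccst.
under [X in C X]funext do rewrite big_cons.
apply: (CM _ _ _ IHr); elim: (m k) => [|e IHe].
  by under [X in C X]funext do rewrite expr0; exact: Ccst.
by under [X in C X]funext do rewrite exprS; exact: CM.
Qed.

Variables (T : Type) (I : finType) (phi : T -> affine_space K I).

(** [F] is a global fraction [q / r] pulled back along [phi], written without division. Since [r]
    has no zero on the image, [F] vanishes exactly where [q] does. *)
Definition regular_in (F : T -> K) : Prop :=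
  exists q r : {mpoly K[#|I|]}, forall t,
    poly_eval r (phi t) != 0 /\ poly_eval q (phi t) = poly_eval r (phi t) * F t.

Lemma regular_in_cst c : regular_in (fun=> c).
Proof.
by exists c%:MP, 1 => t; rewrite poly_evalC poly_eval1 mul1r oner_eq0.
Qed.

Lemma regular_in_coord i : regular_in (fun t => phi t i).
Proof.
exists 'X_(enum_rank i), 1 => t.
by rewrite poly_evalX poly_eval1 mul1r oner_eq0 enum_rankK.
Qed.

Lemma regular_inD F G : regular_in F -> regular_in G -> regular_in (fun t => F t + G t).
Proof.
move=> [q [r H]] [q' [r' H']]; exists (q * r' + q' * r), (r * r') => t.
move: (H t) (H' t); rewrite poly_evalD !poly_evalM => -[rt ->] [rt' ->].
by rewrite mulf_neq0 //; split=> //; ring.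
Qed.

Lemma regular_inM F G : regular_in F -> regular_in G -> regular_in (fun t => F t * G t).
Proof.
move=> [q [r H]] [q' [r' H']]; exists (q * q'), (r * r') => t.
move: (H t) (H' t); rewrite !poly_evalM => -[rt ->] [rt' ->].
by rewrite mulf_neq0 //; split=> //; ring.
Qed.

Lemma regular_inV F :
  (forall t, F t != 0) -> regular_in F -> regular_in (fun t => (F t)^-1).
Proof.
move=> F0 [q [r H]]; exists r, q => t; have [rt ->] := H t.
by rewrite mulf_neq0 // mulfK.
Qed.

Lemma regular_in_eq F G : F =1 G -> regular_in F -> regular_in G.
Proof. by move=> /funext->. Qed.

Lemma regular_in_poly (J : finType) (psi : T -> affine_space K J) p :
  (forall j, regular_in (fun t => psi t j)) ->
  regular_in (fun t => poly_eval p (psi t)).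
Proof.
apply: poly_eval_ind; [exact: regular_in_cst|exact: regular_inD|exact: regular_inM].
Qed.

End RegularFunctions.

(** * Zariski closures in affine space and in its subspaces *)

Section ZariskiClosed.
Local Open Scope classical_set_scope.
Variables (K : fieldType) (I : finType).

Lemma zero_locus_closed (S : set {mpoly K[#|I|]}) :
  closed (zero_locus S : set (affine_space K I)).
Proof. by rewrite -openC; exists S; rewrite setCK. Qed.

Lemma closed_zero_locus (A : set (affine_space K I)) :
  closed A -> exists S, A = zero_locus S.
Proof. by move=> /closed_openC [S]; rewrite setCK => ->; exists S. Qed.

Lemma affine_closureP (A : set (affine_space K I)) x :
  closure A x <->
  (forall p, (forall a, A a -> poly_eval p a = 0) -> poly_eval p x = 0).
Proof.
split=> [clx p pA|vanish].
  have : closed (zero_locus [set p] : set (affine_space K I)) by exact: zero_locus_closed.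
  move=> /(_ x) /=; apply=> //; apply: closureS clx => a Aa _ -> ; exact: pA.
have [S clS] := closed_zero_locus (@closed_closure _ A).
rewrite clS => p Sp; apply: vanish => a Aa.
have : closure A a by exact: subset_closure.
by rewrite clS; exact.
Qed.

Variable (Y : set (affine_space K I)).

Lemma subtype_closed (A : set (set_type Y)) : closed A ->
  exists S, A = set_val @^-1` zero_locus S.
Proof.
move=> /closed_openC [B Bop BA].
have [S SB] : exists S, ~` B = zero_locus S by exact: Bop.
by exists S; rewrite -SB -preimage_setC BA setCK.
Qed.

Lemma subtype_zero_locus_closed S :
  closed (set_val @^-1` zero_locus S : set (set_type Y)).
Proof.
rewrite -openC preimage_setC; exists (~` zero_locus S) => //.
by rewrite openC; exact: zero_locus_closed.
Qed.

Lemma subtype_closureP (A : set (set_type Y)) y :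
  closure A y <->
  (forall p, (forall a, A a -> poly_eval p (set_val a) = 0) -> poly_eval p (set_val y) = 0).
Proof.
split=> [cly p pA|vanish].
  have /(_ y) := @subtype_zero_locus_closed [set p]; apply=> //.
  by apply: closureS cly => a Aa _ ->; exact: pA.
have [S clS] := subtype_closed (@closed_closure _ A).
rewrite clS => p Sp; apply: vanish => a Aa.
have : closure A a by exact: subset_closure.
by rewrite clS; exact.
Qed.

Lemma subtype_continuous (X : topologicalType) (f : X -> set_type Y) :
  (forall p, closed [set x | poly_eval p (set_val (f x)) = 0]) -> continuous f.
Proof.
move=> fcl; apply/continuous_closedP => A /subtype_closed[S ->].
have -> : f @^-1` (set_val @^-1` zero_locus S) =
    \bigcap_(p in S) [set x | poly_eval p (set_val (f x)) = 0].
  by apply/seteqP; split=> x /=.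
exact: closed_bigI.
Qed.

End ZariskiClosed.

(** In characteristic zero the naturals below [size P] are distinct, too many to be all roots. *)
Lemma nonroot_exists (K : numFieldType) (P : {poly K}) : P != 0 -> exists s, P.[s] != 0.
Proof.
move=> P0; apply: contrapT => noex.
have roots : all (root P) [seq i%:R | i <- iota 0 (size P)].
  apply/allP => s _; rewrite /root; apply: contrapT => /negP Ps; by apply: noex; exists s.
have := max_poly_roots P0 roots; rewrite size_map size_iota ltnn => H.
by have /H : uniq [seq i%:R : K | i <- iota 0 (size P)]
  by rewrite map_inj_uniq ?iota_uniq // => i j /eqP; rewrite eqr_nat => /eqP.
Qed.

(** * The parametrized Schubert cell and irreducibility of Y *)

Section Cell.
Local Open Scope classical_set_scope.
Variables (K : numFieldType) (N : nat) (pi : 'S_N).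
Implicit Types b c : 'M[K]_N.

(** Invertibility is put on the diagonal entries, where it is a polynomial condition. Upper
    triangular matrices enter through their transposes. *)
Definition trig_inv b := is_trig_mx b /\ forall i, b i i != 0.

Lemma trig_invP b : trig_inv b <-> b \in unitmx /\ is_trig_mx b.
Proof.
split=> -[H bt]; split=> //.
  by rewrite unitmxE det_trig // unitfE; apply/prodf_neq0 => i _; exact: bt.
by move=> i; move: H; rewrite unitmxE det_trig // unitfE => /prodf_neq0; exact.
Qed.

Definition cell_point b c : affine_space K (L_box pi) :=
  L_projection pi (matrix_point (b *m permutation_matrix K pi *m c)).

Lemma cell_pointE b c x :
  cell_point b c x = \sum_k b (val x).1 (pi k) * c k (val x).2.
Proof.
rewrite !ffunE mxE; apply: eq_bigr => k _; rewrite mxE; congr (_ * _).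
rewrite (bigD1 (pi k)) //= big1 ?addr0 => [|j jk]; first by rewrite mxE eqxx mulr1.
by rewrite mxE eq_sym (negbTE jk) mulr0.
Qed.

Lemma cell_point_Y b c : trig_inv b -> trig_inv c^T -> @Y_pi K N pi (cell_point b c).
Proof.
move=> /trig_invP[bu bt] /trig_invP[cu ct].
exists (matrix_point (b *m permutation_matrix K pi *m c)) => //.
apply: subset_closure; exists (b *m permutation_matrix K pi *m c) => //.
by exists b, c; split=> //; split=> //; rewrite -unitmx_tr.
Qed.

(** Composed with the projection, [p] is regular on the space of all matrices, so its vanishing
    passes from the cell to the Zariski closure. *)
Lemma Y_vanish p :
  (forall b c, trig_inv b -> trig_inv c^T -> poly_eval p (cell_point b c) = 0) ->
  forall y, @Y_pi K N pi y -> poly_eval p y = 0.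
Proof.
move=> vanish _ [M Mcl <-].
have [q [r qr]] : regular_in (T := affine_space K ('I_N * 'I_N)%type) id
    (fun M => poly_eval p (L_projection pi M)).
  apply: regular_in_poly => j; have := @regular_in_coord K _ _ id (val j).
  by apply: regular_in_eq => M'; rewrite ffunE.
suff q0 : poly_eval q M = 0.
  have [rM] := qr M; rewrite q0 => /esym/eqP; rewrite mulf_eq0 (negbTE rM) /=.
  by move/eqP.
move/affine_closureP: Mcl; apply=> _ [_ [b [c [[bu bt] [cu ct] ->]]] <-].
have [_ ->] := qr (matrix_point (b *m permutation_matrix K pi *m c)).
have -> : L_projection pi (matrix_point (b *m permutation_matrix K pi *m c)) =
  cell_point b c by [].
by rewrite vanish ?mulr0 //; apply/trig_invP => //; rewrite unitmx_tr.
Qed.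

Definition line (u v : 'M[K]_N) (s : K) : 'M[K]_N := (1 - s) *: u + s *: v.

(** [D] is the product of the diagonal entries along the line; its value at 0 is the product for
    [u], which is nonzero. *)
Lemma line_trig_inv u v : trig_inv u -> trig_inv v ->
  exists2 D : {poly K}, D != 0 & forall s, D.[s] != 0 -> trig_inv (line u v s).
Proof.
move=> [ut u0] [vt v0].
pose D : {poly K} := \prod_i ((1 - 'X) * (u i i)%:P + 'X * (v i i)%:P).
have DE s : D.[s] = \prod_i (line u v s) i i.
  rewrite horner_prod; apply: eq_bigr => i _.
  by rewrite !hornerE !mxE.
exists D.
  apply/eqP => D0; have := DE 0; rewrite D0 horner0 => /esym/eqP; apply/negP/prodf_neq0 => i _.
  by rewrite !mxE subr0 mul1r mul0r addr0.
move=> s; rewrite DE => /prodf_neq0 Ds; split; last by move=> i; exact: Ds.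
apply/is_trig_mxP => i j ij; rewrite !mxE.
by rewrite (is_trig_mxP ut) // (is_trig_mxP vt) // !mulr0 addr0.
Qed.

Lemma poly_eval_line b1 b2 c1 c2 p : exists P : {poly K}, forall s,
  P.[s] = poly_eval p (cell_point (line b1 b2 s) (line c1 c2 s)).
Proof.
pose C (F : K -> K) := exists P : {poly K}, forall s, P.[s] = F s.
have Ccst a : C (fun=> a) by exists a%:P => s; rewrite hornerC.
have CD F G : C F -> C G -> C (fun s => F s + G s).
  by move=> [P PF] [Q QG]; exists (P + Q) => s; rewrite hornerD PF QG.
have CM F G : C F -> C G -> C (fun s => F s * G s).
  by move=> [P PF] [Q QG]; exists (P * Q) => s; rewrite hornerM PF QG.
have Cline u v i j : C (fun s => (line u v s) i j).
  exists ((1 - 'X) * (u i j)%:P + 'X * (v i j)%:P) => s.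
  by rewrite !hornerE !mxE.
apply: (@poly_eval_ind K K _ (fun s => cell_point (line b1 b2 s) (line c1 c2 s)) C) => // j.
under [X in C X]funext do rewrite cell_pointE.
elim: (index_enum _) => [|k r IHr].
  by under [X in C X]funext do rewrite big_nil; exact: Ccst.
under [X in C X]funext do rewrite big_cons.
by apply: (CD _ _ _ IHr); exact: CM.
Qed.

(* Two points of the cell where p, resp. q, does not vanish are joined by a
   line in the space of pairs (b, c); on it p * q is a nonzero polynomial. *)
Lemma Y_irreducible : irreducible_closed [set: set_type (@Y_pi K N pi)].
Proof.
have id_trig : trig_inv 1%:M.
  split; first exact: scalar_mx_is_trig.
  by move=> i; rewrite mxE eqxx oner_eq0.
split; first exact: closedT.
  have y0 : @Y_pi K N pi (cell_point 1%:M 1%:M) by apply: cell_point_Y; rewrite ?trmx1.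
  by exists (SigSub (mem_set y0)).
move=> A B /subtype_closed[S ->] /subtype_closed[S' ->] cover.
apply: contrapT => /not_orP[nA nB].
(* By [Y_vanish], a closed set not containing Y has an equation that fails at some point of the cell
   itself. *)
have witness (Q : set {mpoly K[#|L_box pi|]}) :
    ~ [set: set_type (@Y_pi K N pi)] `<=` set_val @^-1` zero_locus Q ->
    exists p b c, [/\ Q p, trig_inv b, trig_inv c^T & poly_eval p (cell_point b c) != 0].
  move=> nQ; apply: contrapT => noex; apply: nQ => y _ p Qp.
  apply: Y_vanish => [b c bt ct|]; last exact: set_mem (valP y).
  by apply: contrapT => /eqP nz; apply: noex; exists p, b, c; split.
have [p [b1 [c1 [Sp b1t c1t p0]]]] := witness _ nA.
have [q [b2 [c2 [Sq b2t c2t q0]]]] := witness _ nB.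
have [P PE] := poly_eval_line b1 b2 c1 c2 p.
have [Q QE] := poly_eval_line b1 b2 c1 c2 q.
have [D D0 Db] := line_trig_inv b1t b2t; have [D' D'0 Dc] := line_trig_inv c1t c2t.
have line0 u v : line u v 0 = u by rewrite /line subr0 scale1r scale0r addr0.
have line1 u v : line u v 1 = v by rewrite /line subrr scale1r scale0r add0r.
have P0 : P != 0.
  by apply: contraNneq p0 => P0; move: (PE 0); rewrite P0 horner0 !line0 => <-.
have Q0 : Q != 0.
  by apply: contraNneq q0 => Q0; move: (QE 1); rewrite Q0 horner0 !line1 => <-.
(* The factors [D] and [D'] keep both matrices at parameter [s] invertible, so that the point lies
   in Y. *)
have [s] : exists s, (P * Q * D * D').[s] != 0.
  by apply: nonroot_exists; rewrite !mulf_neq0.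
rewrite !hornerM !mulf_eq0 !negb_or -!andbA => /and4P[Ps Qs /Db bs /Dc cs].
have cT : trig_inv (line c1 c2 s)^T.
  by move: cs; rewrite /line linearD /= !linearZ.
pose y : set_type (@Y_pi K N pi) := SigSub (mem_set (cell_point_Y bs cT)).
case: (cover y I) => /=.
  by move=> /(_ _ Sp) /eqP; rewrite -PE (negbTE Ps).
by move=> /(_ _ Sq) /eqP; rewrite -QE (negbTE Qs).
Qed.

End Cell.

(** * The orbit map of the quotient torus and its regular inverse *)

Section Orbit.
Local Open Scope classical_set_scope.
Local Open Scope quotient_scope.
Variables (K : numFieldType) (N : nat) (pi : 'S_N).
Local Notation torusT := (set_type (@torus K N)).
Local Notation Y := (@Y_pi K N pi).

Variables (y0 : affine_space K (L_box pi)) (x0 : 'I_N * 'I_N).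
Hypotheses (x0L : x0 \in L_region pi) (L_conn : boxes_connected (L_region pi)).
Hypotheses (y0_neq0 : forall x, y0 x != 0) (y0Y : Y y0).
Hypothesis act_Y : forall t : torusT, Y (torus_act (set_val t) y0).

(** The chosen representative does not matter, by [orbit_map_pi]: elements of one coset act alike on
    the point [y0] of Y. *)
Definition orbit_map (z : quotient_torus K pi) : set_type Y :=
  SigSub (mem_set (act_Y (repr z))).

Lemma orbit_map_pi t :
  set_val (orbit_map (\pi_(quotient_torus K pi) t)) = torus_act (set_val t) y0.
Proof.
suff /same_cosetP : same_coset pi (repr (\pi_(quotient_torus K pi) t)) t by apply.
exact/(@eqquotP _ (same_coset_equiv K pi))/reprK.
Qed.

(** The coordinates of [t y0] are regular on the torus, so the preimage of a hypersurface is the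
    zero locus of a numerator. *)
Lemma orbit_map_continuous : continuous orbit_map.
Proof.
apply/quotient_continuous; apply: subtype_continuous => p.
have [q [r qr]] : regular_in (fun t : torusT => set_val t)
    (fun t => poly_eval p (torus_act (set_val t) y0)).
  apply: regular_in_poly => x.
  apply: (@regular_in_eq _ _ _ _ (fun t : torusT =>
    set_val t (inl (val x).1) * y0 x * (set_val t (inr (val x).2))^-1)).
    by move=> t; rewrite ffunE.
  apply: regular_inM; first apply: regular_inM.
  - exact: regular_in_coord.
  - exact: regular_in_cst.
  - apply: regular_inV; first by move=> t; exact: torus_neq0.
    exact: regular_in_coord.
rewrite (_ : [set _ | _] = set_val @^-1` zero_locus [set q]).
  exact: subtype_zero_locus_closed.
apply/seteqP; split=> t /=; rewrite orbit_map_pi; have [rt qt] := qr t.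
  by move=> pt _ ->; rewrite qt pt mulr0.
by move=> /(_ q erefl)/eqP; rewrite qt mulf_eq0 (negbTE rt) => /eqP.
Qed.

Definition graph_vertex (v : 'I_N + 'I_N) := v \in Gpi_rows pi :|: Gpi_cols pi.

(** Scaling all coordinates by a common factor acts trivially, and so do coordinates outside the
    graph. The normal form makes the latter 1 and also the coordinate of the column of [x0]. *)
Definition normalize (s : affine_space K ('I_N + 'I_N)%type) :
    affine_space K ('I_N + 'I_N)%type :=
  [ffun v => if graph_vertex v then s v / s (inr x0.2) else 1].

Lemma normalize_torus (t : torusT) : torus (normalize (set_val t)).
Proof.
move=> v; rewrite ffunE; case: ifP => _; last exact: oner_neq0.
by rewrite mulf_neq0 ?invr_neq0 //; exact: torus_neq0.
Qed.

Definition normal_form (t : torusT) : torusT := SigSub (mem_set (normalize_torus t)).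

Lemma row_vertex x : x \in L_region pi -> graph_vertex (inl x.1).
Proof. by move=> xL; rewrite /graph_vertex inE; apply/orP; left; apply: imset_f. Qed.

Lemma col_vertex x : x \in L_region pi -> graph_vertex (inr x.2).
Proof. by move=> xL; rewrite /graph_vertex inE; apply/orP; right; apply: imset_f. Qed.

Lemma normal_form_pi t :
  \pi_(quotient_torus K pi) (normal_form t) = \pi_(quotient_torus K pi) t.
Proof.
apply/(@eqquotP _ (same_coset_equiv K pi))/same_cosetP => y _.
apply/ffunP => x; rewrite !ffunE row_vertex ?col_vertex ?(valP x) //.
have a0 := torus_neq0 t (inl (val x).1); have b0 := torus_neq0 t (inr (val x).2).
have c0 := torus_neq0 t (inr x0.2).
by field; rewrite b0 c0.
Qed.

Let act (t : torusT) := torus_act (set_val t) y0.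

Lemma box_ratio_regular x : x \in L_region pi ->
  regular_in act (fun t : torusT => set_val t (inl x.1) / set_val t (inr x.2)).
Proof.
move=> xL; pose e : L_box pi := SigSub xL.
apply: (@regular_in_eq _ _ _ _ (fun t => act t e * (y0 e)^-1)).
  by move=> t; rewrite ffunE /= mulrAC mulfK.
by apply: regular_inM; [exact: regular_in_coord|exact: regular_in_cst].
Qed.

(* Along a path of boxes from x0, the ratios t_v / t_(inr x0.2) of the vertices
   met on the way are products of the ratios t_a / t_b of boxes (a, b), and of
   their inverses. *)
Lemma vertex_ratio_regular x : x \in L_region pi ->
  regular_in act (fun t : torusT => set_val t (inl x.1) / set_val t (inr x0.2)) /\
  regular_in act (fun t : torusT => set_val t (inr x.2) / set_val t (inr x0.2)).
Proof.
pose P x := regular_in act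
    (fun t : torusT => set_val t (inl x.1) / set_val t (inr x0.2)) /\
  regular_in act (fun t : torusT => set_val t (inr x.2) / set_val t (inr x0.2)).
have quo_regular y : y \in L_region pi ->
    regular_in act (fun t : torusT => set_val t (inr y.2) / set_val t (inl y.1)).
  move=> yL; apply: regular_in_eq (regular_inV _ (box_ratio_regular yL)) => [t|t].
    by rewrite invf_div.
  by rewrite mulf_neq0 ?invr_neq0 //; exact: torus_neq0.
have mulq F G : regular_in act F -> regular_in act G ->
    forall H, (forall t, F t * G t = H t) -> regular_in act H.
  by move=> HF HG H FGH; exact: regular_in_eq FGH (regular_inM HF HG).
have step y z : box_step (L_region pi) y z -> P y -> P z.
  move=> /and3P[yL zL yz] [Pr Pc].
  have [e|e] : y.1 = z.1 \/ y.2 = z.2.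
    by case/orP: yz => /andP[/eqP-> _]; [left|right].
  - rewrite e in Pr; split=> //; apply: (mulq _ _ (quo_regular _ zL) Pr) => t.
    by rewrite mulrA mulfVK //; exact: torus_neq0.
  - rewrite e in Pc; split=> //; apply: (mulq _ _ (box_ratio_regular zL) Pc) => t.
    by rewrite mulrA mulfVK //; exact: torus_neq0.
move=> xL; change (P x); have /connectP[s] := L_conn x0L xL.
have : P x0.
  split; first exact: box_ratio_regular.
  apply: (@regular_in_eq _ _ _ _ (fun=> 1)); last exact: regular_in_cst.
  by move=> t; rewrite divff //; exact: torus_neq0.
elim: s x0 => [|z s IHs] y Py /=; first by move=> _ ->.
move=> /andP[yz zs] xE; exact: (IHs z (step _ _ yz Py)).
Qed.

(** This is the inverse of the orbit map: the point [t y0] determines a representative of the coset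
    of [t] by regular functions. *)
Lemma normal_form_regular p :
  regular_in act (fun t => poly_eval p (set_val (normal_form t))).
Proof.
apply: regular_in_poly => v; case: (boolP (graph_vertex v)) => [gv|ngv]; last first.
  apply: (@regular_in_eq _ _ _ _ (fun=> 1)); last exact: regular_in_cst.
  by move=> t; rewrite ffunE (negbTE ngv).
apply: (@regular_in_eq _ _ _ _ (fun t : torusT => set_val t v / set_val t (inr x0.2))).
  by move=> t; rewrite ffunE gv.
by move: gv; rewrite /graph_vertex inE => /orP[] /imsetP[x xL ->];
  have [] := vertex_ratio_regular xL.
Qed.

(** Equations of the preimage of [Z] in the torus, evaluated at normal forms, have numerators that
    are polynomials on Y. These vanish on the image of [Z], hence on its closure. *)
Lemma orbit_map_embedding Z : closed Z -> orbit_map @^-1` closure (orbit_map @` Z) `<=` Z.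
Proof.
move=> Zcl z /subtype_closureP zZ.
have piZ_closed : closed (\pi_(quotient_torus K pi) @^-1` Z).
  by apply: preimage_closed Zcl => t _; exact: pi_continuous.
have [S ZS] := subtype_closed piZ_closed.
have nfE w : \pi_(quotient_torus K pi) (normal_form (repr w)) = w.
  by rewrite normal_form_pi reprK.
have mem w : Z w <-> zero_locus S (set_val (normal_form (repr w))).
  by rewrite -{1}(nfE w); have : (\pi @^-1` Z) (normal_form (repr w)) <->
    (set_val @^-1` zero_locus S) (normal_form (repr w)) by rewrite ZS.
apply/mem => p Sp; have [q [r qr]] := normal_form_regular p.
have val_orbit w : set_val (orbit_map w) = act (repr w) by [].
have := zZ q; rewrite val_orbit; have [rz ->] := qr (repr z).
move=> /(_ _)/eqP; rewrite mulf_eq0 (negbTE rz) => H; apply/eqP/H => _ [w Zw <-].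
by rewrite val_orbit (qr (repr w)).2; move/mem: Zw => /(_ _ Sp) ->; rewrite mulr0.
Qed.

Lemma orbit_dense : toric K pi -> forall p,
  (forall t : torusT, poly_eval p (act t) = 0) ->
  forall y, Y y -> poly_eval p y = 0.
Proof.
move=> [d dimT dimY] p pact y Yy.
have dense := dense_range_of_dim orbit_map_continuous orbit_map_embedding
  (Y_irreducible K pi) dimT dimY.
have : closure (range orbit_map) (SigSub (mem_set Yy)) by rewrite dense.
by move/subtype_closureP => /(_ p); apply=> _ [w _ <-]; exact: pact.
Qed.

End Orbit.

(** * Dots north-west of a box, and the regions of the Rothe diagram *)

Section Dots.
Variables (N : nat) (pi : 'S_N).
Implicit Types (x y z : 'I_N * 'I_N) (k : 'I_N).

(** A dot, an entry 1 of the permutation matrix, is named by its column [k]; its row is [pi k]. *)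
Definition dot_nw x k := ((pi k <= x.1) && (k <= x.2))%N.

Lemma dot_nw_le x y k :
  (x.1 <= y.1)%N -> (x.2 <= y.2)%N -> dot_nw x k -> dot_nw y k.
Proof.
by move=> xy1 xy2 /andP[k1 k2]; rewrite /dot_nw (leq_trans k1) // (leq_trans k2).
Qed.

(** The hook description: the diagram is what remains after each dot deletes itself and all
    positions south and east of it. *)
Lemma rotheE x : (x \in rothe pi) = (x.1 < pi x.2)%N && (x.2 < (pi^-1)%g x.1)%N.
Proof.
rewrite inE; apply/existsP/andP => [[i /existsP[j /and3P[ij pij /eqP->]]]|[x1 x2]] /=.
  by rewrite permK.
exists x.2; apply/existsP; exists ((pi^-1)%g x.1).
by rewrite permKV x1 x2 /= -surjective_pairing.
Qed.

Lemma rotheN x k : x \in rothe pi -> dot_nw x k -> (pi k < x.1)%N && (k < x.2)%N.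
Proof.
rewrite rotheE => /andP[x1 x2] /andP[k1 k2]; rewrite !ltn_neqAle k1 k2 !andbT.
apply/andP; split; apply/negP => /eqP/val_inj e.
  by move: x2; rewrite -e permK ltnNge k2.
by move: x1; rewrite -e ltnNge k1.
Qed.

Lemma undotted_rothe x : (forall k, ~~ dot_nw x k) -> x \in rothe pi.
Proof.
move=> nodot; rewrite rotheE; apply/andP; split; rewrite ltnNge; apply/negP => le.
  by move: (nodot x.2); rewrite /dot_nw le leqnn.
by move: (nodot ((pi^-1)%g x.1)); rewrite /dot_nw permKV le leqnn.
Qed.

(** The whole rectangle from the corner to [x] has no dots either, so it lies in the diagram; a path
    runs down the first column and then along the row of [x]. *)
Lemma undotted_dom x : (forall k, ~~ dot_nw x k) -> x \in dom_region pi.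
Proof.
move=> nodot.
have below y : (y.1 <= x.1)%N -> (y.2 <= x.2)%N -> y \in rothe pi.
  move=> y1 y2; apply: undotted_rothe => k; apply: contra (nodot k); exact: dot_nw_le.
have ordP n (i : 'I_N) : (n <= i)%N -> (n < N)%N by move/leq_ltn_trans; apply.
have N0 : (0 < N)%N by exact: (ordP 0 x.1).
pose o := Ordinal N0.
have step y y' : (y.1 <= x.1)%N -> (y.2 <= x.2)%N -> (y'.1 <= x.1)%N -> (y'.2 <= x.2)%N ->
    common_side y y' -> connect (box_step (rothe pi)) y y'.
  by move=> *; apply: connect1; rewrite /box_step /= !below.
have downwards n (i : 'I_N) : (i <= x.1)%N -> n = i :> nat ->
    connect (box_step (rothe pi)) (o, o) (i, o).
  elim: n i => [|n IHn] i ix ni; first by apply: eq_connect0; congr (_, _); exact: val_inj.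
  have nN : (n < N)%N by apply: (ordP _ i); rewrite -ni.
  have nx : (n <= x.1)%N by apply: leq_trans ix; rewrite -ni.
  apply: connect_trans (IHn (Ordinal nN) nx erefl) (step _ _ _ _ _ _ _) => //.
  by rewrite /common_side /= ni eqxx orbT.
have rightwards n (j : 'I_N) : (j <= x.2)%N -> n = j :> nat ->
    connect (box_step (rothe pi)) (x.1, o) (x.1, j).
  elim: n j => [|n IHn] j jx nj; first by apply: eq_connect0; congr (_, _); exact: val_inj.
  have nN : (n < N)%N by apply: (ordP _ j); rewrite -nj.
  have nx : (n <= x.2)%N by apply: leq_trans jx; rewrite -nj.
  apply: connect_trans (IHn (Ordinal nN) nx erefl) (step _ _ _ _ _ _ _) => //.
  by rewrite /common_side /= eqxx nj eqxx.
rewrite inE undotted_rothe //; apply/existsP; exists (o, o); rewrite below //= [X in connect _ _ X]surjective_pairing.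
exact: connect_trans (downwards _ _ (leqnn _) erefl) (rightwards _ _ (leqnn _) erefl).
Qed.

(** The corner has no dot strictly north-west of it. A dot north-west of a diagram box is strictly
    so in both coordinates, hence still weakly north-west of any adjacent box; so no step of a path
    can acquire one. *)
Lemma dom_undotted x k : x \in dom_region pi -> ~~ dot_nw x k.
Proof.
rewrite inE => /andP[_ /existsP[y /and4P[yD /eqP y1 /eqP y2 /connectP[s ys ->]]]].
have : forall k, ~~ dot_nw y k.
  by move=> l; apply/negP => /(rotheN yD); rewrite y1.
elim: s y ys {yD y1 y2} => [|z s IHs] y //= /andP[/and3P[yD zD yz] zs] nody.
apply: IHs zs _ => l; apply/negP => zl; have /andP[l1 l2] := rotheN zD zl.
case/negP: (nody l); rewrite /dot_nw.
case/orP: yz => /andP[/eqP-> /orP[]/eqP e]; rewrite ?(ltnW l1) ?(ltnW l2) //=.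
- by rewrite -ltnS e.
- by rewrite (leq_trans (ltnW l2)) // -e.
- by rewrite andbT -ltnS e.
- by rewrite andbT (leq_trans (ltnW l1)) // -e.
Qed.

(** By the two preceding lemmas, [dom_region] consists exactly of the positions without a dot weakly
    north-west. *)
Lemma L_regionP x :
  reflect (x \in nw_region pi /\ exists k, dot_nw x k) (x \in L_region pi).
Proof.
rewrite /L_region finset.in_setD andbC.
case: (boolP (x \in nw_region pi)) => xnw /=; last by constructor; case.
apply: (iffP negP) => [ndom|[_ [k xk]] xdom].
  split=> //; apply: contrapT => nodot; apply/ndom/undotted_dom => k.
  by apply/negP => xk; apply: nodot; exists k.
by have := dom_undotted k xdom; rewrite xk.
Qed.

Lemma L_region_dotted x y k : x \in L_region pi -> dot_nw y k ->
  (y.1 <= x.1)%N -> (y.2 <= x.2)%N -> y \in L_region pi.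
Proof.
move=> /L_regionP[xnw _] yk y1 y2; apply/L_regionP; split; last by exists k.
move: xnw; rewrite !inE => /existsP[z /and3P[zD x1 x2]].
by apply/existsP; exists z; rewrite zD (leq_trans y1) // (leq_trans y2).
Qed.

Lemma L_region_corner x : x \in L_region pi ->
  exists z, [/\ z \in rothe pi, z \in L_region pi, (x.1 <= z.1)%N & (x.2 <= z.2)%N].
Proof.
move=> /L_regionP[]; rewrite inE => /existsP[z /and3P[zD x1 x2]] [k xk].
exists z; split=> //; apply/L_regionP; split; last by exists k; exact: dot_nw_le xk.
by rewrite inE; apply/existsP; exists z; rewrite zD !leqnn.
Qed.

End Dots.

(** * Toricity forces a single common dot *)

Section ToricDots.
Local Open Scope classical_set_scope.
Variables (K : numFieldType) (N : nat) (pi : 'S_N).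
Hypotheses (pi_toric : toric K pi) (L_conn : boxes_connected (L_region pi)).
Local Notation torusT := (set_type (@torus K N)).
Local Notation Y := (@Y_pi K N pi).

Definition lower_ones : 'M[K]_N := \matrix_(i, j) (j <= i)%:R.

Lemma lower_ones_trig_inv : trig_inv lower_ones.
Proof.
split; last by move=> i; rewrite mxE leqnn oner_neq0.
by apply/is_trig_mxP => i j ij; rewrite mxE leqNgt ij.
Qed.

Definition ones_point : affine_space K (L_box pi) := cell_point pi lower_ones lower_ones^T.

(** The entry at [x] counts the dots weakly north-west of [x]; on L this count is positive, and the
    characteristic is zero. *)
Lemma ones_point_neq0 x : ones_point x != 0.
Proof.
rewrite cell_pointE.
have -> : \sum_k lower_ones (val x).1 (pi k) * (lower_ones^T)%R k (val x).2 =
    (\sum_k dot_nw pi (val x) k)%:R.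
  by rewrite natr_sum; apply: eq_bigr => k _; rewrite !mxE -natrM mulnb.
have /L_regionP[_ [k xk]] := valP x.
by rewrite pnatr_eq0 (bigD1 k) //= xk.
Qed.

Lemma diag_mul_trig_inv (d : 'I_N -> K) (b : 'M[K]_N) :
  (forall i, d i != 0) -> trig_inv b -> trig_inv (\matrix_(i, j) (d i * b i j)).
Proof.
move=> d0 [bt b0]; split; last by move=> i; rewrite mxE mulf_neq0.
by apply/is_trig_mxP => i j ij; rewrite mxE (is_trig_mxP bt) // mulr0.
Qed.

(** The diagonal factors are absorbed into [b] and [c]. *)
Lemma torus_act_cell_point (t : torusT) b c : trig_inv b -> trig_inv c^T ->
  Y (torus_act (set_val t) (cell_point pi b c)).
Proof.
move=> bt ct.
rewrite (_ : torus_act _ _ = cell_point pi (\matrix_(i, j) (set_val t (inl i) * b i j))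
  (\matrix_(i, j) ((set_val t (inr i))^-1 * c^T i j))^T).
  apply: cell_point_Y; rewrite ?trmxK; apply: diag_mul_trig_inv => // i.
    exact: torus_neq0.
  by rewrite invr_neq0 // torus_neq0.
apply/ffunP => x; rewrite ffunE !cell_pointE mulr_sumr mulr_suml.
by apply: eq_bigr => k _; rewrite !mxE; ring.
Qed.

Lemma toric_poly_vanish x p : x \in L_region pi ->
  (forall t : torusT, poly_eval p (torus_act (set_val t) ones_point) = 0) ->
  forall y, Y y -> poly_eval p y = 0.
Proof.
move=> xL; have otT : trig_inv (lower_ones^T)^T by rewrite trmxK; exact: lower_ones_trig_inv.
have act_Y t := torus_act_cell_point t lower_ones_trig_inv otT.
apply: (orbit_dense xL L_conn ones_point_neq0 _ act_Y pi_toric).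
exact: cell_point_Y lower_ones_trig_inv otT.
Qed.

Section Minor.
Variables (s : K) (c d i1 i2 j1 j2 : 'I_N).

(** Multiplication by it on the left adds rows [i1] and [i2] to row [c]. *)
Definition minor_left : 'M[K]_N :=
  \matrix_(x, y) ((x == y)%:R + (x == c)%:R * ((y == i1)%:R + (y == i2)%:R)).

(** Multiplication by it on the right adds column [j1] and [s] times column [j2] to column [d]. *)
Definition minor_right : 'M[K]_N :=
  \matrix_(x, y) ((x == y)%:R + (y == d)%:R * ((x == j1)%:R + s * (x == j2)%:R)).

Lemma minor_left_trig_inv : (i1 < c)%N -> (i2 < c)%N -> trig_inv minor_left.
Proof.
move=> i1c i2c.
have neq (i : 'I_N) : (i < c)%N -> (c == i) = false.
  by move=> ic; apply/eqP => ci; move: ic; rewrite ci ltnn.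
split=> [|x]; last first.
  rewrite mxE eqxx; have [->|_] := eqVneq x c; last by rewrite mul0r addr0 oner_neq0.
  by rewrite !neq // addr0 mulr0 addr0 oner_neq0.
apply/is_trig_mxP => x y xy; rewrite mxE.
have -> : (x == y) = false by apply/eqP => e; move: xy; rewrite e ltnn.
have [xc|_] := eqVneq x c; last by rewrite mul0r addr0.
rewrite xc in xy; have -> : (y == i1) = false.
  by apply/eqP => e; move: xy; rewrite e ltnNge (ltnW i1c).
have -> : (y == i2) = false.
  by apply/eqP => e; move: xy; rewrite e ltnNge (ltnW i2c).
by rewrite addr0 mulr0 addr0.
Qed.

Lemma minor_right_trig_inv : (j1 < d)%N -> (j2 < d)%N -> trig_inv minor_right^T.
Proof.
move=> j1d j2d.
have neq (j : 'I_N) : (j < d)%N -> (d == j) = false.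
  by move=> jd; apply/eqP => dj; move: jd; rewrite dj ltnn.
split=> [|x]; last first.
  rewrite !mxE eqxx; have [->|_] := eqVneq x d; last by rewrite mul0r addr0 oner_neq0.
  by rewrite !neq // mulr0 addr0 mulr0 addr0 oner_neq0.
apply/is_trig_mxP => x y xy; rewrite !mxE.
have -> : (y == x) = false by apply/eqP => e; move: xy; rewrite e ltnn.
have [xd|_] := eqVneq x d; last by rewrite mul0r addr0.
rewrite xd in xy; have -> : (y == j1) = false.
  by apply/eqP => e; move: xy; rewrite e ltnNge (ltnW j1d).
have -> : (y == j2) = false.
  by apply/eqP => e; move: xy; rewrite e ltnNge (ltnW j2d).
by rewrite mulr0 addr0 mulr0 addr0.
Qed.

End Minor.

Lemma sum_dot (F : 'I_N -> K) r : \sum_k (pi k == r)%:R * F k = F ((pi^-1)%g r).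
Proof.
rewrite (bigD1 ((pi^-1)%g r)) //= permKV eqxx mul1r big1 ?addr0 // => k kr.
by rewrite -(inj_eq (@perm_inj _ (pi^-1)%g)) permK (negbTE kr) mul0r.
Qed.

(* The four boxes (pi k1, k1), (pi k1, d), (c, k1), (c, d) satisfy a binomial
   relation on the orbit, hence on all of Y.  The points below have entries
   1, 1, 1, 1 + s there, which contradicts the relation when s varies. *)
Lemma no_two_dots z k1 k2 : z \in rothe pi -> dot_nw pi z k1 -> dot_nw pi z k2 ->
  (pi k1 < pi k2)%N -> False.
Proof.
case: z => c d zD zk1 zk2 k12.
have /andP[/= pk1 dk1] := rotheN zD zk1; have /andP[/= pk2 dk2] := rotheN zD zk2.
have zL : (c, d) \in L_region pi.
  apply/L_regionP; split; last by exists k1.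
  by rewrite inE; apply/existsP; exists (c, d); rewrite zD !leqnn.
have box (u v : 'I_N) : (pi k1 <= u)%N -> (k1 <= v)%N -> (u <= c)%N -> (v <= d)%N ->
    (u, v) \in L_region pi.
  by move=> *; apply: (L_region_dotted (k := k1) zL) => //; apply/andP.
have L11 : (pi k1, k1) \in L_region pi by apply: box => //; exact: ltnW.
have L12 : (pi k1, d) \in L_region pi by apply: box => //; exact: ltnW.
have L21 : (c, k1) \in L_region pi by apply: box => //; exact: ltnW.
pose e11 : L_box pi := SigSub L11; pose e12 : L_box pi := SigSub L12.
pose e21 : L_box pi := SigSub L21; pose e22 : L_box pi := SigSub zL.
pose X e : {mpoly K[#|L_box pi|]} := 'X_(enum_rank e).
have XE e (y : affine_space K (L_box pi)) : poly_eval (X e) y = y e.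
  by rewrite poly_evalX enum_rankK.
(* Both monomials of the 2 x 2 minor are scaled by the same torus factor, so their ratio on the
   orbit is the one at [ones_point]. *)
pose u := ones_point e12 * ones_point e21; pose v := ones_point e11 * ones_point e22.
have binomial y : Y y -> u * (y e11 * y e22) = v * (y e12 * y e21).
  move=> Yy; apply/eqP; rewrite -subr_eq0; apply/eqP.
  have := @toric_poly_vanish _ (u%:MP * (X e11 * X e22) - v%:MP * (X e12 * X e21)) zL.
  have pE y' : poly_eval (u%:MP * (X e11 * X e22) - v%:MP * (X e12 * X e21)) y' =
      u * (y' e11 * y' e22) - v * (y' e12 * y' e21).
    by rewrite poly_evalB !poly_evalM !poly_evalC !XE.
  have actE (t : torusT) y' e : torus_act (set_val t) y' e =
      set_val t (inl (val e).1) * y' e * (set_val t (inr (val e).2))^-1 by rewrite ffunE.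
  rewrite -pE; apply=> // t; rewrite pE !actE /= /u /v; ring.
pose b := minor_left c (pi k1) (pi k2); pose g s := minor_right s d k1 k2.
have pointE s e : cell_point pi b (g s) e =
    g s ((pi^-1)%g (val e).1) (val e).2 +
    ((val e).1 == c)%:R * (g s k1 (val e).2 + g s k2 (val e).2).
  rewrite cell_pointE; under eq_bigr => k _ do
    rewrite mxE eq_sym mulrDl -mulrA mulrDl.
  rewrite big_split /= sum_dot -mulr_sumr big_split /=.
  by rewrite !sum_dot !permK.
have neq (i j : 'I_N) : (i < j)%N -> ((i == j) = false) * ((j == i) = false).
  by move=> ij; rewrite [j == i]eq_sym; split; apply/eqP => e; move: ij; rewrite e ltnn.
have k12' : (k1 == k2) = false by apply/eqP => e; move: k12; rewrite e ltnn.
have [/= _ cd] := andP (etrans (esym (rotheE pi (c, d))) zD).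
(* The dot of row [c] is in column [m], to the right of [d], so it contributes to none of the four
   entries. *)
set m := (pi^-1)%g c in cd.
have mk k : (pi k < c)%N -> (m == k) = false.
  by move=> kc; apply/eqP => e; move: kc; rewrite -e permKV ltnn.
have Y_point s : Y (cell_point pi b (g s)).
  by apply: cell_point_Y; [exact: minor_left_trig_inv|exact: minor_right_trig_inv].
have simp := (neq _ _ cd, neq _ _ dk1, neq _ _ dk2, neq _ _ pk1,
  mk _ pk1, mk _ pk2, k12', eq_sym k2 k1).
have v11 s : cell_point pi b (g s) e11 = 1 by rewrite pointE /= permK !mxE !eqxx !simp /=; ring.
have v12 s : cell_point pi b (g s) e12 = 1 by rewrite pointE /= permK !mxE !eqxx !simp /=; ring.
have v21 s : cell_point pi b (g s) e21 = 1 by rewrite pointE /= -/m !mxE !eqxx !simp /=; ring.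
have v22 s : cell_point pi b (g s) e22 = 1 + s by rewrite pointE /= -/m !mxE !eqxx !simp /=; ring.
(* The relation reads [u * (1 + s) = v]; comparing [s = 0] with [s = 1] leaves [u = 0]. *)
have /eqP : u = 0.
  have := binomial _ (Y_point 0); have := binomial _ (Y_point 1).
  rewrite !v11 !v12 !v21 !v22 addr0 !mul1r => <-.
  by rewrite mulrDr => /eqP; rewrite -subr_eq0 opprD addNKr oppr_eq0 mulr1 => /eqP.
by rewrite /u mulf_eq0 !(negbTE (ones_point_neq0 _)).
Qed.

(** Both dots are also north-west of a diagram box south-east of [x], where distinct dots, ordered
    by their rows, are excluded by [no_two_dots]. *)
Lemma toric_dot_unique x k1 k2 : x \in L_region pi ->
  dot_nw pi x k1 -> dot_nw pi x k2 -> k1 = k2.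
Proof.
move=> xL xk1 xk2; have [z [zD _ z1 z2]] := L_region_corner xL.
have zk1 := dot_nw_le z1 z2 xk1; have zk2 := dot_nw_le z1 z2 xk2.
have [|lt|/val_inj/perm_inj//] := ltngtP (pi k1) (pi k2).
  by case/(no_two_dots zD zk1 zk2).
by case: (no_two_dots zD zk2 zk1 lt).
Qed.

(** Adjacent boxes are comparable: a dot of the smaller one is a dot of the larger one, and
    uniqueness at the larger one identifies the two. The dot is carried along a path in L. *)
Lemma toric_common_dot x k : x \in L_region pi -> dot_nw pi x k ->
  forall y, y \in L_region pi -> dot_nw pi y k.
Proof.
move=> xL xk y yL; have /connectP[s] := L_conn xL yL.
elim: s x xk {xL} => [|z s IHs] x xk /=; first by move=> _ ->.
move=> /andP[/and3P[xL zL xz] zs] yE; apply: (IHs z _ zs yE).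
have [k' zk'] : exists k', dot_nw pi z k' by have /L_regionP[] := zL.
have [[x1 x2]|[z1 z2]] : ((x.1 <= z.1) /\ (x.2 <= z.2))%N \/ ((z.1 <= x.1) /\ (z.2 <= x.2))%N.
  by case/orP: xz => /andP[/eqP-> /orP[]/eqP<-]; rewrite ?leqnn ?leqnSn; [left|right|left|right].
  exact: dot_nw_le xk.
by rewrite (toric_dot_unique xL xk (dot_nw_le z1 z2 zk')).
Qed.

End ToricDots.

(** * The graph of the permutation and its two hubs *)

Lemma Gpi_edge_sym N (pi : 'S_N) u v : Gpi_edge pi u v = Gpi_edge pi v u.
Proof. by case: u v => [a|b] [a'|b']. Qed.

Lemma Gpi_bipartite N (pi : 'S_N) : bipartite (Gpi_edge pi) (Gpi_rows pi) (Gpi_cols pi).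
Proof.
split=> [|[a|b] [a'|b'] //= xL].
  rewrite -finset.setI_eq0; apply/eqP/setP=> v; rewrite finset.in_setI finset.in_set0.
  by apply/negP => /andP[/imsetP[x _ ->] /imsetP[]].
- by apply/orP; left; apply/andP; split; apply/imsetP; exists (a, b').
- by apply/orP; right; apply/andP; split; apply/imsetP; exists (a', b).
Qed.

Theorem lemma4p5 (R : realType) (N : nat) (pi : 'S_N)
  (toric_Y : toric (complex R) pi) (L_connected : boxes_connected (L_region pi)) :
  let U1 := Gpi_rows pi in
  let U2 := Gpi_cols pi in
  let e := Gpi_edge pi in
  (forall A : {set 'I_N + 'I_N},
     first_independent U1 U2 e A && one_sided U1 U2 e A <->
     (exists2 u, u \in U1 & A = U1 :\ u) \/ (exists2 u, u \in U2 & A = U2 :\ u))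
  /\
  (forall A : {set 'I_N + 'I_N},
     first_independent U1 U2 e A && two_sided U1 U2 e A <->
     two_sided U1 U2 e A && maximal_independent U1 U2 e A).
Proof.
move=> U1 U2 e; have [L0|[x xL]] := set_0Vmem (L_region pi).
  (* With L empty there are no vertices, hence no independent sets, and both sides of each
     equivalence are false. *)
  have U10 : U1 = finset.set0 by rewrite /U1 /Gpi_rows L0 imset0.
  have U20 : U2 = finset.set0 by rewrite /U2 /Gpi_cols L0 imset0.
  have nind A : independent U1 U2 e A = false.
    rewrite /independent /vertices U10 U20 finset.setU0 finset.subset0.
    by case: eqP.
  split=> A; rewrite /one_sided /two_sided nind ?andbF //; split=> // -[] [u].
    by rewrite U10 inE.
  by rewrite U20 inE.
have /L_regionP[_ [k xk]] := xL.
have hub y : y \in L_region pi -> dot_nw pi y k.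
  exact: (toric_common_dot toric_Y L_connected xL xk).
(* Moving a box of L to the row or to the column of the common dot stays in L: this makes row [pi k]
   and column [k] hubs. *)
have box y : y \in L_region pi -> (pi k, y.2) \in L_region pi /\ (y.1, k) \in L_region pi.
  move=> yL; have /andP[y1 y2] := hub _ yL.
  by split; apply: (L_region_dotted (k := k) yL) => //; rewrite /dot_nw leqnn ?y1 ?y2.
(* A diagram box lies strictly south-east of the dot, which provides a second row and a second
   column. *)
have [z [zD zL _ _]] := L_region_corner xL.
have /andP[z1 z2] := rotheN zD (hub _ zL).
have [zrow zcol] := box _ zL.
have two (U : {set 'I_N + 'I_N}) u v : u \in U -> v \in U -> u != v -> (1 < #|U|)%N.
  move=> uU vU uv; rewrite (cardsD1 u) uU ltnS card_gt0; apply/set0Pn; exists v.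
  by rewrite !inE eq_sym uv.
have rU1 y : y \in L_region pi -> inl y.1 \in U1 by move=> yL; apply/imsetP; exists y.
have cU2 y : y \in L_region pi -> inr y.2 \in U2 by move=> yL; apply/imsetP; exists y.
apply: (hubs_first_independent (@Gpi_edge_sym _ pi) (Gpi_bipartite pi)
  (rU1 _ zrow) (cU2 _ zcol)).
- by move=> _ /imsetP[y yL ->]; case: (box _ yL).
- by move=> _ /imsetP[y yL ->]; case: (box _ yL).
- apply: (two _ _ _ (rU1 _ zrow) (rU1 _ zL)); apply/eqP => -[e1].
  by move: z1; rewrite e1 ltnn.
- apply: (two _ _ _ (cU2 _ zcol) (cU2 _ zL)); apply/eqP => -[e1].
  by move: z2; rewrite e1 ltnn.
Qed.
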